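(* Let $\mathcal H$ be a real Hilbert space, $I=\{1,\dots,m\}$, and for every $i\in I$ let $U_i\colon\mathcal H\to\mathcal H$ be a cutter, $p_i\colon\mathcal H\to[0,\infty)$ a function, and $C_i\subseteq\mathcal H$ a set with $C_i=\operatorname{Fix}U_i=p_i^{-1}(0)$. Assume $C:=\bigcap_{i\in I}C_i\neq\emptyset$. Let the sequence $\{x^k\}_{k=0}^\infty$ be defined by $$x^0\in\mathcal H;\qquad x^{k+1}:=x^k+\alpha_k\Big(\sum_{i\in I_k}\omega_i^kU_ix^k-x^k\Big)\quad\text{for }k=0,1,2,\ldots,$$ where $I_k\subseteq J_k\subseteq I$, $\alpha_k\in(0,2)$ and $\omega_i^k\in(0,1]$ ($i\in I_k$) are such that $\sum_{i\in I_k}\omega_i^k=1$. Assume that (i) $\alpha_k\in[\alpha^-,\alpha^+]$ and $\omega_i^k\in[\omega^-,1]$ for all $k$ and all $i\in I_k$, where $\alpha^-,\omega^-\in(0,1]$ and $\alpha^+\in[1,2)$; (ii) $I=J_k\cup\ldots\cup J_{k+s-1}$ for every $k=0,1,2,\ldots$ and some integer $s\geq1$; (iii) the following implication holds: $$\lim_{k\to\infty}\max_{i\in I_k}p_i(x^k)=0\quad\Longrightarrow\quad\lim_{k\to\infty}\max_{j\in J_k}p_j(x^k)=0;$$ (iv) for every bounded sequence $\{y^k\}_{k=0}^\infty\subseteq\mathcal H$ and every $i\in I$, $$\lim_{k\to\infty}p_i(y^k)=0\quad\Longleftrightarrow\quad\lim_{k\to\infty}\|U_iy^k-y^k\|=0.$$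 If for each $i\in I$ the operator $U_i$ is weakly regular, then $\{x^k\}_{k=0}^\infty$ converges weakly to some point $x^\infty\in C$. Moreover, if for each $i\in I$ the operator $U_i$ is boundedly regular and the family $\mathcal C:=\{\operatorname{Fix}U_i\mid i\in I\}$ is boundedly regular, then the convergence to $x^\infty$ is in norm.
   Context: For an operator $U\colon\mathcal H\to\mathcal H$, $\operatorname{Fix}U:=\{z\in\mathcal H\mid Uz=z\}$. $U$ is a cutter if $\operatorname{Fix}U\neq\emptyset$ and $\langle z-Ux,x-Ux\rangle\leq0$ for all $x\in\mathcal H$ and $z\in\operatorname{Fix}U$ (the fixed point set of a cutter is closed and convex). The distance function is $d(x,C):=\inf_{z\in C}\|x-z\|$. An operator $U$ with $\operatorname{Fix}U\ne\emptyset$ is weakly regular if for every sequence $\{y^k\}\subseteq\mathcal H$ and $y^\infty\in\mathcal H$ such that $y^k\rightharpoonup y^\infty$ (weak convergence) and $Uy^k-y^k\to0$ (in norm), one has $y^\infty\in\operatorname{Fix}U$. It is boundedly regular if for every bounded sequence $\{y^k\}\subseteq\mathcal H$, $\lim_k\|Uy^k-y^k\|=0$ implies $\lim_kd(y^k,\operatorname{Fix}U)=0$. A finite family $\mathcal C=\{C_i\mid i\in I\}$ of closed convex sets with $C:=\bigcap_{i\in I}C_i\neq\emptyset$ is boundedly regular if for every bounded sequence $\{y^k\}\subseteq\mathcal H$, $\lim_k\max_{i\in I}d(y^k,C_i)=0$ implies $\lim_kd(y^k,C)=0$. *)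

(* Defs.v *)
From mathcomp Require Export all_boot all_order all_algebra.
From mathcomp Require Export all_classical all_reals all_analysis.

Set Implicit Arguments.
Unset Strict Implicit.
Unset Printing Implicit Defensive.

Export Order.TTheory GRing.Theory Num.Theory numFieldNormedType.Exports.

Local Open Scope classical_set_scope.
Local Open Scope ring_scope.

(* A real Hilbert space is a complete normed module [H] over a [realType]
   together with a symmetric positive definite form [dot : {dot H for idfun}]
   which induces the norm of [H]. *)
Definition induces_norm (R : realType) (H : completeNormedModType R)
    (dot : {dot H for idfun}) : Prop :=
  forall x : H, `|x| = Num.sqrt (dot x x).

Definition weak_cvg (R : realType) (H : completeNormedModType R)
    (dot : {dot H for idfun}) (y : nat -> H) (l : H) : Prop :=
  forall z : H, dot (y k) z @[k --> \oo] --> dot l z.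

Definition Fix (T : Type) (U : T -> T) : set T := [set z | U z = z].

Definition cutter (R : realType) (H : completeNormedModType R)
    (dot : {dot H for idfun}) (U : H -> H) : Prop :=
  Fix U !=set0 /\
  forall x z : H, Fix U z -> dot (z - U x) (x - U x) <= 0.

(* As [inf set0 = 0], this is the distance function only for [C !=set0]. *)
Definition dist (R : realType) (H : completeNormedModType R)
    (x : H) (C : set H) : R :=
  inf [set `|x - z| | z in C].

Definition weakly_regular (R : realType) (H : completeNormedModType R)
    (dot : {dot H for idfun}) (U : H -> H) : Prop :=
  Fix U !=set0 /\
  forall (y : nat -> H) (l : H),
    weak_cvg dot y l -> U (y k) - y k @[k --> \oo] --> (0 : H) -> Fix U l.

Definition boundedly_regular (R : realType) (H : completeNormedModType R)
    (U : H -> H) : Prop :=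
  Fix U !=set0 /\
  forall y : nat -> H, bounded_fun y ->
    `|U (y k) - y k| @[k --> \oo] --> (0 : R) ->
    dist (y k) (Fix U) @[k --> \oo] --> (0 : R).

(* Meant for closed convex [C i]; the fixed point sets of cutters are such.
   The default 0 of the maximum is harmless since distances are nonnegative. *)
Definition boundedly_regular_family (R : realType)
    (H : completeNormedModType R) (I : finType) (C : I -> set H) : Prop :=
  \bigcap_i C i !=set0 /\
  forall y : nat -> H, bounded_fun y ->
    \big[Num.max/0]_(i : I) dist (y k) (C i) @[k --> \oo] --> (0 : R) ->
    dist (y k) (\bigcap_i C i) @[k --> \oo] --> (0 : R).

(* Main.v *)
Require Import Defs.
From mathcomp Require Import ring lra.

(** Why the theorem holds.  For a cutter [U] with fixed point [z] the
    displacement satisfies [`|U u - u|^2 <= <z - u, U u - u>].  Averaging over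
    the active indices and expanding the square, one relaxed step decreases
    [`|x k - z|^2] by at least [alpha_k (2 - alpha_k)] times the weighted sum
    of the squared residuals [`|U_i (x k) - x k|^2], [i \in I k]
    ([relaxed_average_step]).  So the sequence is Fejer monotone with respect
    to [C]; the distances [`|x k - z|] converge, hence the decrements vanish,
    hence so do the active residuals and the steps [x k.+1 - x k]
    ([averaged_cutters_residuals]).

    The residuals of the operators in [J k] vanish as well: proximities and
    residuals are equivalent along bounded sequences, and replacing [x k] by a
    point of [C] whenever an index is not active turns a statement about the
    active steps into one about a bounded sequence ([residual_transfer]); the
    passage from [I k] to [J k] is then the assumed implication on
    proximities.  As every index is in some [J l] with [k <= l < k + s], and
    the steps vanish, every index [i] has a sequence of times [l i k], within
    bounded distance of [k], with [x (l i k) - x k] and the [i]-th residual at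
    [x (l i k)] tending to 0.

    If the operators are weakly regular, every weak limit of a subsequence of
    [x] is also a weak limit along the shifted times, hence is fixed by each
    [U i].  Opial's argument ([opial_weak_cvg]) then gives weak convergence:
    two weak cluster points [y], [y'] in [C] have converging distances to [x],
    so [<x k, y - y'>] converges and [y = y'].  It needs the weak sequential
    compactness of bounded sequences ([bounded_weak_subseq]), for which the
    weak limit is found along an ultrafilter with the Riesz representation
    theorem; a subsequence is extracted whose deviations from that limit are
    almost orthogonal to one another, and such sequences are weakly null.

    If the operators and the family of their fixed point sets are boundedly
    regular, the distances of [x (l i k)], hence of [x k], to each [Fix (U i)]
    vanish, hence so do those to [C].  A Fejer monotone sequence with this
    property is Cauchy ([fejer_cvg]), and its limit is adherent to each
    [Fix (U i)], which is closed. *)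

Local Open Scope classical_set_scope.
Local Open Scope ring_scope.

(** * Real sequences and finite families *)

Lemma squeeze0 (R : realFieldType) (f g : nat -> R) :
  (forall k, 0 <= f k <= g k) -> g @ \oo --> 0 -> f @ \oo --> 0.
Proof.
move=> fg; apply: (@squeeze_cvgr _ _ _ _ (fun=> 0)); last exact: cvg_cst.
exact: filterE.
Qed.

Lemma sqr_cvg0 (R : realFieldType) (f : nat -> R) :
  f k ^+ 2 @[k --> \oo] --> 0 -> f @ \oo --> 0.
Proof.
move=> /cvgr0Pnorm_lt f2; apply/cvgr0Pnorm_lt => e e0.
near=> k; rewrite -(@ltr_pXn2r _ 2%N) ?nnegrE ?(ltW e0) // -normrX.
by near: k; apply: f2; rewrite exprn_gt0.
Unshelve. all: by end_near. Qed.

(** A maximum over a moving index set is handled through one sequence per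
    index, set to 0 at the times when the index is absent: the maximum
    dominates each of these sequences and is dominated by their sum. *)
Lemma cvg_bigmax_in0 (R : realType) (T : finType) (A : nat -> {set T})
    (a : nat -> T -> R) : (forall k i, 0 <= a k i) ->
  \big[Num.max/0]_(i in A k) a k i @[k --> \oo] --> (0 : R) <->
  forall i, (if i \in A k then a k i else 0) @[k --> \oo] --> (0 : R).
Proof.
move=> a0; split=> [amax i|acvg].
  apply: squeeze0 amax => k; case: ifP => iA; last first.
    by rewrite lexx bigmax_ge_id.
  by rewrite a0 (le_bigmax_cond 0 (a k)).
apply: (@squeeze0 _ _ (fun k => \sum_i if i \in A k then a k i else 0)).
  have h0 k i : 0 <= if i \in A k then a k i else 0 by case: ifP.
  move=> k; rewrite bigmax_ge_id; apply: bigmax_le => [|i iA].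
    exact: sumr_ge0.
  by rewrite (bigD1 i) //= iA lerDl sumr_ge0.
rewrite -[X in _ --> X](@big1 _ 0 +%R T (index_enum T) xpredT (fun=> 0)) //.
apply: cvg_big => [|i _]; [exact: add_continuous|exact: acvg].
Qed.

Lemma natr_mul_le1 (R : realDomainType) (m n : nat) (c : R) :
  (m <= n)%N -> n%:R * c <= 1 -> m%:R * c <= 1.
Proof.
move=> mn; have [c0 _|c0] := lerP c 0.
  by apply: le_trans ler01; rewrite mulr_ge0_le0.
by apply: le_trans; rewrite ler_pM2r // ler_nat.
Qed.

Lemma mem_bigcup_nat (T : finType) (F : nat -> {set T}) (a b : nat) (i : T) :
  i \in (\bigcup_(a <= l < b) F l)%SET -> exists2 l, (a <= l < b)%N & i \in F l.
Proof.
rewrite big_nat.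
apply: (big_ind (fun S : {set T} =>
  i \in S -> exists2 l, (a <= l < b)%N & i \in F l)).
- by rewrite inE.
- by move=> S S' hS hS' /setUP[/hS|/hS'].
- by move=> l ab il; exists l.
Qed.

(** * Subsequences and ultrafilter limits *)

Lemma increasing_seq_ge (h : nat -> nat) k : increasing_seq h -> (k <= h k)%N.
Proof.
move=> /increasing_seqP hS; elim: k => // k IH; exact: leq_ltn_trans IH (hS k).
Qed.

Lemma cvgn_id_le (h : nat -> nat) :
  (forall k, (k <= h k)%N) -> h k @[k --> \oo] --> \oo.
Proof.
move=> hk A [N _ NA]; exists N => // k /= Nk; apply: NA.
exact: leq_trans (hk k).
Qed.

Lemma frequently_subseq (P : nat -> Prop) :
    (forall N, exists2 k, (N <= k)%N & P k) ->
  exists2 h : nat -> nat, increasing_seq h & forall k, P (h k).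
Proof.
move=> Pinf; have next a : {b | (a < b)%N /\ P b}.
  by apply: cid; have [b ab Pb] := Pinf a.+1; exists b.
have [h [_ hP]] := dependent_choice next 0%N.
exists (h \o S) => [|k /=]; last by have [] := hP k.
by apply/increasing_seqP => k; have [] := hP k.+1.
Qed.

(** The image of the ultrafilter clusters in a segment by compactness, and an
    ultrafilter converges to each of its cluster points. *)
Lemma ultra_bounded_cvg (R : realType) (r : nat -> R) (M : R)
    (G : set_system nat) :
  UltraFilter G -> (forall k, `|r k| <= M) -> exists l : R, r @ G --> l.
Proof.
move=> GU rM; have GP := ultra_proper.
have [l [_ ll]] : `[- M, M]%classic `&` cluster (r @ G) !=set0.
  apply: segment_compact; apply: (@filterE _ G) => k /=.
  by rewrite in_itv /= -ler_norml.
exists l => A lA; have [//|GnA] := in_ultra_setVsetC (r @^-1` A) GU.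
by have [t []] := ll (~` A) A GnA lA.
Qed.

(** * Sequences in normed modules *)

Lemma bounded_seqP (R : realType) (V : normedModType R) (x : nat -> V) :
  bounded_fun x <-> exists M : R, forall k, `|x k| <= M.
Proof.
have F := @globally_properfilter nat setT 0%N I.
split=> [/ex_bound[M xM]|[M xM]]; first by exists M => k; exact: xM.
by apply/ex_bound; exists M => k _; exact: xM.
Qed.

Lemma cauchy_seq_cvg (R : realType) (H : completeNormedModType R)
    (x : nat -> H) :
  (forall e : R, 0 < e -> exists N, forall m n, (N <= m)%N -> (N <= n)%N ->
     `|x m - x n| < e) -> exists l : H, x @ \oo --> l.
Proof.
move=> xC; suff /cvg_ex : cvgn x by [].
apply/cauchy_cvgP/cauchy_exP => e /xC[N xN].
by exists (x N), N => // n Nn; rewrite -ball_normE /=; exact: xN.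
Qed.

(** The point [x (l k)] is reached from [x k] in at most [s] steps, so the
    distance is at most a sum of [s] terms, each of which vanishes. *)
Lemma cvg0_window (R : realType) (H : normedModType R) (x : nat -> H)
    (s : nat) (l : nat -> nat) :
  (forall k, (k <= l k < k + s)%N) ->
  x k.+1 - x k @[k --> \oo] --> (0 : H) ->
  x (l k) - x k @[k --> \oo] --> (0 : H).
Proof.
move=> lP dx; apply/norm_cvg0P.
apply: (@squeeze0 _ _ (fun k => \sum_(j < s) `|x (k + j).+1 - x (k + j)%N|)).
  move=> k; rewrite normr_ge0 /=; have /andP[kl lks] := lP k.
  rewrite -(subnKC kl).
  have : (l k - k <= s)%N by rewrite leq_subLR ltnW.
  move: (l k - k)%N => n ns; pose d j := `|x (k + j).+1 - x (k + j)%N|.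
  apply: (@le_trans _ _ (\sum_(j < n) d j)).
    elim: n {ns} => [|n IH]; first by rewrite addn0 subrr normr0 big_ord0.
    rewrite big_ord_recr /= addnS addrC; apply: le_trans (lerD (lexx _) IH).
    by apply: le_trans (ler_normD _ _); rewrite addrA subrK.
  rewrite (big_ord_widen _ d ns) big_mkcond /=.
  by apply: ler_sum => j _; case: ifP.
rewrite -[X in _ --> X](@big1 _ 0 +%R 'I_s (index_enum 'I_s) xpredT (fun=> 0)) //.
apply: cvg_big => [|i _]; first exact: add_continuous.
apply: (@cvg_comp _ _ _ (fun k => (k + i)%N) (fun k => `|x k.+1 - x k|)).
  exact: cvg_addnr.
exact/norm_cvg0P.
Qed.

Lemma fejer_norm_cvg (R : realType) (H : normedModType R)
    (x : nat -> H) (z : H) :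
  (forall k, `|x k.+1 - z| <= `|x k - z|) -> cvgn (fun k => `|x k - z|).
Proof.
move=> fejer; apply: nonincreasing_is_cvgn; first exact/nonincreasing_seqP.
by exists 0 => _ [k _ <-].
Qed.

(** The equivalence between [p] and the residual of [U] holds along bounded
    sequences, not along a subset of times.  Restricting to the times in [b]
    amounts to replacing [x k] at the other times by a point [z] at which both
    quantities are 0. *)
Lemma residual_transfer (R : realType) (H : normedModType R)
    (U : H -> H) (p : H -> R) (b : nat -> bool) (x : nat -> H) (z : H) :
    (forall y : nat -> H, bounded_fun y ->
      p (y k) @[k --> \oo] --> (0 : R) <->
      `|U (y k) - y k| @[k --> \oo] --> (0 : R)) ->
    bounded_fun x -> U z = z -> p z = 0 ->
  (if b k then p (x k) else 0) @[k --> \oo] --> (0 : R) <->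
  (if b k then `|U (x k) - x k| else 0) @[k --> \oo] --> (0 : R).
Proof.
move=> pU /bounded_seqP[M xM] Uz pz.
pose y k := if b k then x k else z.
have yM : bounded_fun y.
  apply/bounded_seqP; exists (Num.max M `|z|) => k; rewrite /y le_max.
  by case: ifP => _; rewrite ?xM ?lexx ?orbT.
have -> : (fun k => if b k then p (x k) else 0) = (fun k => p (y k)).
  by apply/funext => k; rewrite /y; case: ifP.
have -> : (fun k => if b k then `|U (x k) - x k| else 0) =
    (fun k => `|U (y k) - y k|).
  by apply/funext => k; rewrite /y; case: ifP; rewrite // Uz subrr normr0.
exact: pU.
Qed.

(** * Distance to a set *)

Section Distance.
Context (R : realType) (H : completeNormedModType R).
Implicit Types (u v : H) (S : set H).

Lemma dist_lbound u S : has_lbound [set `|u - z| | z in S].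
Proof. by exists 0 => _ [z _ <-]. Qed.

Lemma dist_ge0 u S : 0 <= dist u S.
Proof.
rewrite /dist; have [->|S0] := eqVneq S set0.
  by rewrite image_set0 inf0.
apply: lb_le_inf; last by move=> _ [z _ <-].
by have /set0P[z Sz] := S0; exists `|u - z|, z.
Qed.

Lemma dist_lt u S (e : R) : S !=set0 -> dist u S < e ->
  exists2 z, S z & `|u - z| < e.
Proof.
move=> [z Sz] de; have [||_ [w Sw <-] we] :=
  @inf_adherent _ [set `|u - z| | z in S] (e - dist u S).
- by rewrite subr_gt0.
- by split; [exists `|u - z|, z|exact: dist_lbound].
- by exists w => //; move: we; rewrite -/(dist u S) subrKC.
Qed.

Lemma dist_le_add u v S : S !=set0 -> dist u S <= `|u - v| + dist v S.
Proof.
move=> S0; rewrite -lerBlDl; apply: lb_le_inf.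
  by have [z Sz] := S0; exists `|v - z|, z.
move=> _ [z Sz <-]; rewrite lerBlDl; apply: le_trans (ler_distD v u z).
by apply: ge_inf; [exact: dist_lbound|exists z].
Qed.

End Distance.

(** * Inner products, the Riesz representation and weak compactness *)

Section InnerProduct.
Context (R : realType) (H : completeNormedModType R) (dot : {dot H for idfun}).
Implicit Types (u v w : H) (c : R).

Lemma dotC u v : dot u v = dot v u.
Proof. by rewrite hermitian_subproof /= mul1r. Qed.

Lemma dotDl u v w : dot (u + v) w = dot u w + dot v w.
Proof. exact: linearDl. Qed.

Lemma dotNl u w : dot (- u) w = - dot u w.
Proof. exact: linearNl. Qed.

Lemma dotZl c u w : dot (c *: u) w = c * dot u w.
Proof. exact: linearZl_LR. Qed.

Lemma dotDr u v w : dot w (u + v) = dot w u + dot w v.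
Proof. exact: linearDr. Qed.

Lemma dotNr u w : dot w (- u) = - dot w u.
Proof. exact: linearNr. Qed.

Lemma dotZr c u w : dot w (c *: u) = c * dot w u.
Proof. by rewrite dotC dotZl dotC. Qed.

Lemma dot0l w : dot 0 w = 0.
Proof. exact: linear0l. Qed.

Lemma dot_suml (J : Type) (r : seq J) (P : pred J) (E : J -> H) w :
  dot (\sum_(i <- r | P i) E i) w = \sum_(i <- r | P i) dot (E i) w.
Proof. exact: linear_sumlz. Qed.

Lemma dot_sumr (J : Type) (r : seq J) (P : pred J) (E : J -> H) w :
  dot w (\sum_(i <- r | P i) E i) = \sum_(i <- r | P i) dot w (E i).
Proof. exact: linear_sumr. Qed.

Definition dotE := (dotDl, dotDr, dotNl, dotNr, dotZl, dotZr).

Lemma dot_ge0 u : 0 <= dot u u.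
Proof.
have [->|/neq0_dnorm_gt0 /ltW //] := eqVneq u 0.
by rewrite dot0l.
Qed.

Hypothesis dot_norm : induces_norm dot.

Lemma dotxx u : dot u u = `|u| ^+ 2.
Proof. by rewrite dot_norm sqr_sqrtr ?dot_ge0. Qed.

Lemma cauchy_schwarz u v : `|dot u v| <= `|u| * `|v|.
Proof.
have le_sq : dot u v ^+ 2 <= (`|u| * `|v|) ^+ 2.
  have [->|v0] := eqVneq v 0; first by rewrite dotC dot0l normr0 mulr0.
  have v_gt0 : 0 < `|v| ^+ 2 by rewrite exprn_gt0 ?normr_gt0.
  (* the squared distance from [u] to its projection on the line of [v] *)
  have := dot_ge0 (`|v| ^+ 2 *: u - dot u v *: v).
  rewrite !dotE !dotxx (dotC v u) exprMn => h.
  suff : 0 <= `|v| ^+ 2 * (`|u| ^+ 2 * `|v| ^+ 2 - dot u v ^+ 2).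
    by rewrite pmulr_rge0 // subr_ge0.
  by apply: le_trans h _; rewrite le_eqVlt; apply/orP; left; apply/eqP; ring.
by rewrite -(@ler_pXn2r _ 2%N) ?nnegrE ?mulr_ge0 // -normrX ger0_norm ?sqr_ge0.
Qed.

Lemma dot_le u v : dot u v <= `|u| * `|v|.
Proof. exact: le_trans (ler_norm _) (cauchy_schwarz u v). Qed.

Lemma cvg_weak (x : nat -> H) l : x @ \oo --> l -> weak_cvg dot x l.
Proof.
move=> xl z; apply/subr_cvg0/norm_cvg0P.
apply: (@squeeze_cvgr _ _ _ _ (fun=> 0) (fun k => `|x k - l| * `|z|)).
- by near=> k; rewrite normr_ge0 -dotNl -dotDl cauchy_schwarz.
- exact: cvg_cst.
- rewrite -[X in _ --> X](mul0r `|z|); apply: cvgMr_tmp.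
  by apply/norm_cvg0P/subr_cvg0.
Unshelve. all: by end_near. Qed.

Lemma weak_cvg_shift (x y : nat -> H) l :
  y k - x k @[k --> \oo] --> (0 : H) -> weak_cvg dot x l -> weak_cvg dot y l.
Proof.
move=> /cvg_weak yx xl z; rewrite -[X in _ --> X]addr0 -[X in _ + X](dot0l z).
rewrite [X in X @ _ --> _](_ : _ =
  (fun k => dot (x k) z + dot (y k - x k) z)); last first.
  by apply/funext => k; rewrite !dotE subrKC.
by apply: cvgD; [exact: xl|exact: yx].
Qed.

(** The representing vector minimises [f u = <u, u> - 2 * L u], bounded below
    because [L] is bounded.  A minimising sequence is Cauchy by the
    parallelogram identity, and at its limit the first variation of [f] in
    the direction [w], which is [2 * (<y, w> - L w)], has to vanish. *)
Lemma riesz_representation (L : H -> R) (M : R) :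
    (forall u v, L (u + v) = L u + L v) -> (forall c u, L (c *: u) = c * L u) ->
    (forall u, `|L u| <= M * `|u|) ->
  exists y, forall z, L z = dot y z.
Proof.
move=> LD LZ LM; pose f u := dot u u - 2 * L u.
have f_lb : has_lbound (range f).
  exists (- M ^+ 2) => _ [u _ <-]; rewrite /f dotxx.
  have : L u <= M * `|u| by exact: le_trans (ler_norm _) (LM u).
  by have := sqr_ge0 (`|u| - M); lra.
pose d := inf (range f).
have d_le u : d <= f u by apply: ge_inf => //; exists u.
have [z zP] : exists z : nat -> H, forall n, f (z n) < d + n.+1%:R^-1.
  have : forall n, exists u, f u < d + n.+1%:R^-1.
    move=> n; have [||_ [u _ <-] ?] := @inf_adherent _ (range f) n.+1%:R^-1.
    - by rewrite invr_gt0.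
    - by split => //; exists (f 0); exists 0.
    - by exists u.
  by move=> /choice[z zP]; exists z.
have near_min n k : (n <= k)%N -> f (z k) < d + n.+1%:R^-1.
  move=> nk; apply: lt_le_trans (zP k) _.
  by rewrite lerD2l lef_pV2 ?posrE ?ltr0n // ler_nat.
have [y zy] : exists y : H, z @ \oo --> y.
  apply: cauchy_seq_cvg => e e0.
  have e4 : 0 < e ^+ 2 / 4 by rewrite divr_gt0 ?exprn_gt0.
  have [N NP] : exists N, (N.+1%:R^-1 : R) < e ^+ 2 / 4.
    have /cvgr0Pnorm_lt/(_ _ e4)[N _ NP] := @cvg_harmonic R.
    by exists N; apply: le_lt_trans (ler_norm _) (NP N _) => /=.
  exists N => m n /near_min fm /near_min fn.
  rewrite -(@ltr_pXn2r _ 2%N) ?nnegrE ?(ltW e0) // -dotxx.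
  (* the parallelogram identity compares [z m] and [z n] with their midpoint *)
  have := d_le (2^-1 *: (z m + z n)); move: fm fn NP.
  rewrite /f !(LD, LZ, dotE) (dotC (z n) (z m)).
  by move: (N.+1%:R^-1) => /= h; lra.
exists y => w; pose c := dot y w - L w.
(* The inequality holds for [z n] up to [n.+1%:R^-1]; as [z n] enters it
   linearly only, weak convergence is enough to pass to the limit. *)
have minimal t : 0 <= 2 * t * c + t ^+ 2 * dot w w.
  have cvg_c : 2 * t * (dot (z n) w - L w) + t ^+ 2 * dot w w + n.+1%:R^-1
      @[n --> \oo] --> 2 * t * c + t ^+ 2 * dot w w + 0.
    apply: cvgD; last exact: cvg_harmonic.
    apply: cvgD; last exact: cvg_cst.
    by apply: cvgMl_tmp; apply: cvgB; [exact: cvg_weak|exact: cvg_cst].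
  rewrite -[leRHS]addr0 -(cvg_lim _ cvg_c) //; apply: limr_ge.
    by apply/cvg_ex; eexists; exact: cvg_c.
  near=> n; have := d_le (z n + t *: w); have := zP n.
  rewrite /f !(LD, LZ, dotE) (dotC w (z n)).
  by move: (n.+1%:R^-1) => /= h; lra.
suff : c = 0 by rewrite /c; lra.
(* The minimising [t] is [- c / dot w w]; adding 1 to the denominator avoids
   the case [w = 0] and keeps the value negative unless [c = 0]. *)
have W0 : 0 < dot w w + 1 by rewrite ltr_wpDl ?dot_ge0.
have := minimal (- c / (dot w w + 1)).
have -> : 2 * (- c / (dot w w + 1)) * c + (- c / (dot w w + 1)) ^+ 2 * dot w w
  = - (c / (dot w w + 1)) ^+ 2 * (dot w w + 2).
  by field; rewrite gt_eqF.
rewrite mulNr oppr_ge0 pmulr_lle0; last by rewrite ltr_wpDl ?dot_ge0.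
by rewrite le_eqVlt ltNge sqr_ge0 orbF sqrf_eq0 mulf_eq0 invr_eq0 (gt_eqF W0)
  orbF => /eqP.
Unshelve. all: by end_near. Qed.

(** Along an ultrafilter all the bounded scalar sequences [dot (x k) z]
    converge at once; their limits form a bounded linear functional of [z],
    which the Riesz theorem represents by a vector. *)
Lemma weak_ultralimit (x : nat -> H) (M : R) (G : set_system nat) :
    UltraFilter G -> (forall k, `|x k| <= M) ->
  exists y : H, forall z, dot (x k) z @[k --> G] --> dot y z.
Proof.
move=> GU xM; have GP := ultra_proper.
have /choice[L LP] z : exists l : R, dot (x k) z @[k --> G] --> l.
  apply: (@ultra_bounded_cvg R _ (M * `|z|)) => k.
  by apply: le_trans (cauchy_schwarz _ _) _; rewrite ler_wpM2r.
have [||z|y yP] := @riesz_representation L M.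
- move=> u v; apply: (cvg_unique _ (LP (u + v))) => //.
  by rewrite /=; under eq_fun do rewrite dotDr; exact: cvgD.
- move=> a u; apply: (cvg_unique _ (LP (a *: u))) => //.
  by rewrite /=; under eq_fun do rewrite dotZr; exact: cvgMl_tmp.
- apply: (ler_cvg_to (cvg_norm (LP z)) (cvg_cst _)).
  apply: filterE => k; apply: le_trans (cauchy_schwarz _ _) _.
  by rewrite ler_wpM2r.
by exists y => z; rewrite -yP.
Qed.

(** If [dot (w k) z >= e] held for infinitely many [k], the sum [S] of [N]
    such terms would satisfy [N * e <= dot S z <= `|S| * `|z|], while almost
    orthogonality keeps [`|S|] of order [sqrt N] only. *)
Lemma almost_orthogonal_weak0 (w : nat -> H) (B : R) :
    (forall k, `|w k| <= B) ->
    (forall j k, (j < k)%N -> k%:R * dot (w k) (w j) <= 1) ->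
  weak_cvg dot w 0.
Proof.
move=> wB ortho.
(* Applied to [z] and to [- z], the one-sided bound gives convergence. *)
suff small z e : 0 < e -> \forall k \near \oo, dot (w k) z < e.
  move=> z; rewrite dot0l; apply/cvgr0Pnorm_lt => e e0.
  near=> k; rewrite ltr_norml; apply/andP; split; last by near: k; exact: small.
  by rewrite ltrNl -dotNr; near: k; exact: small.
move=> e0; apply: contrapT => nsmall.
have [|h h_incr hP] := @frequently_subseq (fun k => e <= dot (w k) z).
  move=> N; apply: contrapT => nex; apply: nsmall; exists N => // k /= Nk.
  by rewrite ltNge; apply/negP => ek; apply: nex; exists k.
have dot_h j k : (j < k)%N -> k%:R * dot (w (h k)) (w (h j)) <= 1.
  move=> jk; apply: natr_mul_le1 (ortho (h j) (h k) _).
    exact: increasing_seq_ge.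
  by rewrite (leqW_mono h_incr).
pose S N := \sum_(i < N) w (h i).
have S_norm N : `|S N| ^+ 2 <= N%:R * (B ^+ 2 + 2).
  elim: N => [|N IH]; first by rewrite /S big_ord0 normr0 expr0n mul0r.
  rewrite -dotxx /S big_ord_recr /= -/(S N) !dotE dotxx (dotC (w _)) !dotxx.
  have : dot (S N) (w (h N)) <= 1.
    rewrite dotC dot_sumr; case: N {IH} => [|N]; first by rewrite big_ord0.
    apply: (@le_trans _ _ (\sum_(i < N.+1) N.+1%:R^-1)).
      apply: ler_sum => i _; rewrite -[leRHS]mul1r ler_pdivlMr ?ltr0n //.
      by rewrite mulrC dot_h.
    by rewrite sumr_const card_ord -[_ *+ _]mulr_natl divff.
  have : `|w (h N)| ^+ 2 <= B ^+ 2.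
    by rewrite ler_pXn2r ?nnegrE // (le_trans _ (wB 0%N)).
  move: IH; rewrite -natr1; lra.
have S_dot N : N%:R * e <= dot (S N) z.
  rewrite dot_suml -[N in N%:R]card_ord -sumr_const mulr_suml.
  by apply: ler_sum => i _; rewrite mul1r.
have bound N : N.+1%:R * e ^+ 2 <= (B ^+ 2 + 2) * `|z| ^+ 2.
  rewrite -(@ler_pM2l _ N.+1%:R) ?ltr0n // mulrA [leRHS]mulrA.
  apply: (@le_trans _ _ (`|S N.+1| ^+ 2 * `|z| ^+ 2)); last first.
    by rewrite ler_wpM2r ?sqr_ge0.
  rewrite -expr2 -!exprMn ler_pXn2r ?nnegrE ?mulr_ge0 ?(ltW e0) //.
  exact: le_trans (S_dot _) (dot_le _ _).
have := bound (Num.truncn ((B ^+ 2 + 2) * `|z| ^+ 2 / e ^+ 2)).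
rewrite leNgt -ltr_pdivrMr ?exprn_gt0 // => /negP; apply.
exact: truncnS_gt.
Unshelve. all: by end_near. Qed.

(** The indices are chosen one after the other so that the deviations from the
    limit [y] along an ultrafilter are almost orthogonal, which
    gives convergence against every [z] by [almost_orthogonal_weak0]. *)
Lemma bounded_weak_subseq (x : nat -> H) (M : R) :
    (forall k, `|x k| <= M) ->
  exists2 h : nat -> nat, increasing_seq h &
    exists y, weak_cvg dot (x \o h) y.
Proof.
move=> xM.
have [G [GU ooG]] := @ultraFilterLemma nat \oo _.
have GP := ultra_proper.
have [y yP] := weak_ultralimit _ _ _ GU xM.
pose e k := x k - y.
(* Controlling [dot (e b) (e j)] for all [j <= a], and not just for the
   indices already selected, makes the choice of [b] depend on [a] alone. *)
have next a : {b | (a < b)%N /\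
    forall j, (j <= a)%N -> a.+1%:R * dot (e b) (e j) <= 1}.
  apply: cid.
  have : G [set b | (a < b)%N /\
      forall j : 'I_a.+1, a.+1%:R * dot (e b) (e j) <= 1].
    apply: filterI; first by apply: ooG; exists a.+1.
    apply: filter_forall => j.
    have : a.+1%:R * dot (e b) (e j) @[b --> G] --> (0 : R).
      rewrite -[X in _ --> X](mulr0 a.+1%:R) -[X in _ * X](subrr (dot y (e j))).
      apply: cvgMl_tmp; under eq_fun do rewrite dotDl dotNl.
      by apply: cvgB; [exact: yP|exact: cvg_cst].
    by move=> /cvgr_le; apply.
  move=> /filter_ex[b [ab bP]]; exists b; split => // j ja.
  exact: (bP (Ordinal (ja : (j < a.+1)%N))).
have [h [_ hP]] := dependent_choice next 0%N.
have h_incr : increasing_seq h by apply/increasing_seqP => k; have [] := hP k.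
exists h => //; exists y => z; apply/subr_cvg0.
rewrite -(dot0l z).
rewrite [X in X @ _ --> _](_ : _ = fun k => dot (e (h k)) z); last first.
  by apply/funext => k; rewrite /e dotDl dotNl.
apply: (@almost_orthogonal_weak0 (e \o h) (M + `|y|)) => [k|j [//|k] jk].
  by rewrite /= (le_trans (ler_normB _ _)) ?lerD2r.
have [_ /(_ (h j))] := hP k.
rewrite leEnat in h_incr; rewrite h_incr -ltnS => /(_ jk).
by apply: natr_mul_le1; rewrite ltnS increasing_seq_ge.
Qed.
End InnerProduct.

(** * Cutters, averaged steps and Fejér monotone sequences *)

Section Convergence.
Context (R : realType) (H : completeNormedModType R) (dot : {dot H for idfun}).
Hypothesis dot_norm : induces_norm dot.

Let dotxx := dotxx R H dot dot_norm.

Lemma sqr_norm_average_le (T : finType) (A : {set T}) (w : T -> R)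
    (v : T -> H) :
  (forall i, i \in A -> 0 <= w i) -> \sum_(i in A) w i = 1 ->
  `|\sum_(i in A) w i *: v i| ^+ 2 <= \sum_(i in A) w i * `|v i| ^+ 2.
Proof.
move=> w0 w1; set a := \sum_(i in A) w i *: v i.
(* the variance of the weighted family is nonnegative *)
have : 0 <= \sum_(i in A) w i * `|v i - a| ^+ 2.
  by apply: sumr_ge0 => i /w0 wi; rewrite mulr_ge0 ?sqr_ge0.
under eq_bigr do rewrite -dotxx !dotE (dotC _ _ _ a) !dotxx.
rewrite [X in 0 <= X -> _](_ : _ = \sum_(i in A) w i * `|v i| ^+ 2
     - 2 * \sum_(i in A) w i * dot (v i) a + (\sum_(i in A) w i) * `|a| ^+ 2); last first.
  rewrite mulr_sumr mulr_suml -sumrB -big_split; apply: eq_bigr => i _ /=; ring.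
rewrite w1 mul1r.
have -> : \sum_(i in A) w i * dot (v i) a = `|a| ^+ 2.
  rewrite -dotxx {2}/a dot_suml; apply: eq_bigr => i _.
  by rewrite dotZl.
lra.
Qed.

Lemma cutter_residual (U : H -> H) (x z : H) : cutter dot U -> Fix U z ->
  `|U x - x| ^+ 2 <= dot (z - x) (U x - x).
Proof.
move=> [_ Ucut] /(Ucut x); rewrite -dotxx !dotE (dotC _ _ _ x (U x)); lra.
Qed.

(** This is the closedness of the fixed point set of a cutter: by
    [cutter_residual] the residual at [l] is at most the distance from [l] to
    any fixed point. *)
Lemma cutter_Fix_adherent (U : H -> H) (l : H) : cutter dot U ->
  (forall e : R, 0 < e -> exists2 z, Fix U z & `|l - z| < e) -> Fix U l.
Proof.
move=> Ucut near_l; apply/eqP; rewrite -subr_eq0 -normr_le0.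
apply/ler_addgt0Pl => e e0; rewrite addr0.
have [z Uz lz] := near_l _ e0; apply: le_trans (ltW lz).
have [->|r0] := eqVneq `|U l - l| 0; first exact: normr_ge0.
rewrite -(@ler_pM2r _ `|U l - l|) ?lt_def ?r0 //= -expr2.
apply: le_trans (cutter_residual _ _ _ Ucut Uz) _.
by rewrite distrC dot_le.
Qed.

(** With [v] the averaged displacement, [`|y - z|^2] expands as
    [`|x - z|^2 - 2 * a * <z - x, v> + a^2 * `|v|^2].  The weighted sum [r] of
    squared residuals is a lower bound of [<z - x, v>], by the cutter
    property, and an upper bound of [`|v|^2], by convexity. *)
Lemma relaxed_average_step (T : finType) (U : T -> H -> H) (A : {set T})
    (w : T -> R) (a : R) (x z : H) :
  (forall i, cutter dot (U i)) -> (forall i, Fix (U i) z) ->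
  (forall i, i \in A -> 0 <= w i) -> \sum_(i in A) w i = 1 -> 0 <= a ->
  let r := \sum_(i in A) w i * `|U i x - x| ^+ 2 in
  let y := x + a *: (\sum_(i in A) w i *: U i x - x) in
  `|y - z| ^+ 2 <= `|x - z| ^+ 2 - a * (2 - a) * r /\
  `|y - x| ^+ 2 <= a ^+ 2 * r.
Proof.
move=> Ucut Uz w0 w1 a0 r y; pose v := \sum_(i in A) w i *: (U i x - x).
have yE : y = x + a *: v.
  rewrite /y /v; congr (_ + _ *: _).
  under [RHS]eq_bigr do rewrite scalerBr.
  by rewrite sumrB -scaler_suml w1 scale1r.
have vr : `|v| ^+ 2 <= r by exact: sqr_norm_average_le.
have rv : r <= dot (z - x) v.
  rewrite dot_sumr; apply: ler_sum => i iA.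
  by rewrite dotZr ler_wpM2l ?w0 //; apply: cutter_residual.
split; last first.
  rewrite yE addrC addKr normrZ exprMn real_normK ?num_real //.
  by rewrite ler_wpM2l ?sqr_ge0.
have -> : `|y - z| ^+ 2 =
    `|x - z| ^+ 2 - 2 * a * dot (z - x) v + a ^+ 2 * `|v| ^+ 2.
  rewrite yE -!dotxx !dotE.
  by rewrite (dotC _ _ _ x z) (dotC _ _ _ v z) (dotC _ _ _ v x); ring.
have : a * r <= a * dot (z - x) v by rewrite ler_wpM2l.
have : a ^+ 2 * `|v| ^+ 2 <= a ^+ 2 * r by rewrite ler_wpM2l ?sqr_ge0.
lra.
Qed.

(** Opial's lemma.  If [x] stayed away from its weak cluster point [y] when
    tested against [z], a subsequence doing so would have a weak cluster point
    [y'], also in [S].  Since [`|x k - y'|^2 - `|x k - y|^2] is affine in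
    [dot (x k) (y - y')], the latter converges; its limit along the two
    subsequences is both [dot y (y - y')] and [dot y' (y - y')], so [y' = y],
    a contradiction. *)
Lemma opial_weak_cvg (x : nat -> H) (S : set H) :
  S !=set0 -> (forall z, S z -> cvgn (fun k => `|x k - z|)) ->
  (forall h y, (forall k, (k <= h k)%N) -> weak_cvg dot (x \o h) y -> S y) ->
  exists2 y : H, S y & weak_cvg dot x y.
Proof.
move=> [z0 Sz0] xS clusterS.
have [M xM] : exists M, forall k, `|x k| <= M.
  have [B xB] := (bounded_seqP _ _ _).1 (cvg_seq_bounded (xS _ Sz0)).
  exists (B + `|z0|) => k; rewrite -[x k](subrK z0).
  apply: le_trans (ler_normD _ _) _; rewrite lerD2r.
  by have := xB k; rewrite /= normr_id.
have subseq (h : nat -> nat) : exists2 g : nat -> nat, (forall k, (k <= g k)%N) &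
    exists y, weak_cvg dot (x \o (h \o g)) y.
  have [|g g_incr gy] := @bounded_weak_subseq _ _ _ dot_norm (x \o h) M.
    by move=> k; exact: xM.
  by exists g => // k; exact: increasing_seq_ge.
have [g g_ge [y gy]] := subseq id.
have Sy : S y by exact: clusterS g_ge gy.
exists y => // z.
apply/cvgrPdist_lt => e e0; apply: contrapT => nsmall.
have [|h h_incr hP] := @frequently_subseq (fun k => e <= `|dot y z - dot (x k) z|).
  move=> N; apply: contrapT => nex; apply: nsmall; exists N => // k /= Nk.
  by rewrite ltNge; apply/negP => ek; apply: nex; exists k.
have [f f_ge [y' fy']] := subseq h.
have hf_ge k : (k <= h (f k))%N.
  by apply: leq_trans (f_ge k) _; exact: increasing_seq_ge.
have Sy' : S y' by exact: clusterS fy'.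
have [c cP] : exists c : R, dot (x k) (y - y') @[k --> \oo] --> c.
  have /cvg_ex[/= b bP] := xS _ Sy; have /cvg_ex[/= b' bP'] := xS _ Sy'.
  exists (2^-1 * (b' * b' - b * b + (dot y y - dot y' y'))).
  rewrite [X in X @ _ --> _](_ : _ = fun k => 2^-1 *
     (`|x k - y'| * `|x k - y'| - `|x k - y| * `|x k - y| + (dot y y - dot y' y'))).
    apply: cvgMl_tmp; apply: cvgD; last exact: cvg_cst.
    by apply: cvgB; apply: cvgM.
  apply/funext => k; rewrite -!expr2 -!dotxx !dotE.
  rewrite (dotC _ _ _ (x k) y) (dotC _ _ _ (x k) y'); by field.
have yc : dot y (y - y') = c.
  apply: (cvg_unique _ (gy (y - y'))) => //.
  exact: (cvg_comp _ _ (cvgn_id_le _ g_ge) cP).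
have yc' : dot y' (y - y') = c.
  apply: (cvg_unique _ (fy' (y - y'))) => //.
  exact: (cvg_comp _ _ (cvgn_id_le _ hf_ge) cP).
have yy' : y' = y.
  apply/esym/eqP; rewrite -subr_eq0 -normr_eq0 -sqrf_eq0 -dotxx.
  by rewrite dotDl dotNl yc yc' subrr.
have /cvgrPdist_lt/(_ _ e0)[N _ /(_ N (leqnn N))] := fy' z.
by rewrite yy' /= ltNge hP.
Qed.

(** Once a term is within [e] of a point of [S], all later terms are within
    [e] of that same point, so the sequence is Cauchy.  As [S] is not
    assumed closed, the limit is only known to be adherent to it. *)
Lemma fejer_cvg (x : nat -> H) (S : set H) :
  S !=set0 -> (forall z k, S z -> `|x k.+1 - z| <= `|x k - z|) ->
  dist (x k) S @[k --> \oo] --> (0 : R) ->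
  exists2 l : H, x @ \oo --> l &
    forall e : R, 0 < e -> exists2 z, S z & `|l - z| < e.
Proof.
move=> S0 fejer dist0.
have near_S e : 0 < e -> exists z, S z /\
    exists N, forall k, (N <= k)%N -> `|x k - z| < e.
  move=> e0; have /cvgr0Pnorm_lt/(_ _ e0)[N _ NP] := dist0.
  have [z Sz zN] :=
    dist_lt _ _ _ _ _ S0 (le_lt_trans (ler_norm _) (NP N (leqnn N))).
  exists z; split => //; exists N => k Nk; apply: le_lt_trans zN.
  rewrite -(subnKC Nk); elim: (k - N)%N => [|n IH]; first by rewrite addn0.
  by rewrite addnS; apply: le_trans (fejer _ _ Sz) IH.
have [l xl] : exists l : H, x @ \oo --> l.
  apply: cauchy_seq_cvg => e e0.
  have [z [_ [N NP]]] := near_S (e / 2) ltac:(by rewrite divr_gt0).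
  exists N => a b Na Nb; apply: le_lt_trans (ler_distD z _ _) _.
  by rewrite (splitr e) ltrD ?NP // distrC NP.
exists l => // e e0.
have [z [Sz [N NP]]] := near_S (e / 2) ltac:(by rewrite divr_gt0).
exists z => //.
have /cvgrPdist_lt/(_ (e / 2))[|K _ KP] := xl; first by rewrite divr_gt0.
apply: le_lt_trans (ler_distD (x (maxn N K)) _ _) _.
by rewrite (splitr e) ltrD ?NP ?KP //= ?leq_maxl ?leq_maxr.
Qed.

End Convergence.

(** By [relaxed_average_step], the weighted sums of squared residuals are
    bounded by a constant times the decrements of the convergent sequence
    [`|x k - z0|^2], and thus tend to 0; they bound both the steps and, as the
    weights stay away from 0, each active residual. *)
Lemma averaged_cutters_residuals (R : realType) (H : completeNormedModType R)
    (dot : {dot H for idfun}) (dot_norm : induces_norm dot)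
    (T : finType) (U : T -> H -> H) (A : nat -> {set T}) (alpha : nat -> R)
    (w : nat -> T -> R) (a_lo a_hi w_lo : R) (x : nat -> H) :
    (forall i, cutter dot (U i)) -> \bigcap_i Fix (U i) !=set0 ->
    0 < a_lo -> a_hi < 2 -> (forall k, a_lo <= alpha k <= a_hi) ->
    0 < w_lo -> (forall k i, i \in A k -> w_lo <= w k i) ->
    (forall k, \sum_(i in A k) w k i = 1) ->
    (forall k, x k.+1 =
       x k + alpha k *: (\sum_(i in A k) w k i *: U i (x k) - x k)) ->
  [/\ forall z k, (\bigcap_i Fix (U i)) z -> `|x k.+1 - z| <= `|x k - z|,
      x k.+1 - x k @[k --> \oo] --> (0 : H) &
      forall i, (if i \in A k then `|U i (x k) - x k| else 0)
        @[k --> \oo] --> (0 : R)].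
Proof.
move=> Ucut [z0 Uz0] a_lo0 a_hi2 a_bounds w_lo0 w_bounds w1 x_rec.
have w0 k i : i \in A k -> 0 <= w k i.
  by move=> /w_bounds; apply: le_trans; exact: ltW.
have al0 k : 0 <= alpha k.
  by have /andP[+ _] := a_bounds k; apply: le_trans; exact: ltW.
pose r k := \sum_(i in A k) w k i * `|U i (x k) - x k| ^+ 2.
have r0 k : 0 <= r k.
  by apply: sumr_ge0 => i /w0 wi; rewrite mulr_ge0 ?sqr_ge0.
have step k z : (\bigcap_i Fix (U i)) z ->
    `|x k.+1 - z| ^+ 2 <= `|x k - z| ^+ 2 - alpha k * (2 - alpha k) * r k /\
    `|x k.+1 - x k| ^+ 2 <= alpha k ^+ 2 * r k.
  move=> Uz; rewrite x_rec; apply: (relaxed_average_step _ _ _ dot_norm) => //.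
  - by move=> i; exact: Uz.
  - exact: w0.
pose c := a_lo * (2 - a_hi).
have c0 : 0 < c by rewrite mulr_gt0 // subr_gt0.
have c_le k : c <= alpha k * (2 - alpha k).
  have /andP[lo hi] := a_bounds k.
  by apply: ler_pM; rewrite ?(ltW a_lo0) // ?subr_ge0 ?(ltW a_hi2) // lerB.
have fejer z k : (\bigcap_i Fix (U i)) z -> `|x k.+1 - z| <= `|x k - z|.
  move=> Uz; rewrite -(@ler_pXn2r _ 2%N) ?nnegrE //.
  apply: le_trans (step k z Uz).1 _; rewrite gerBl mulr_ge0 //.
  by apply: le_trans (c_le k); exact: ltW.
have r_cvg0 : r @ \oo --> 0.
  have /cvg_ex[/= d dP] := fejer_norm_cvg _ _ x z0 (fun k => fejer _ k Uz0).
  pose D k := `|x k - z0| ^+ 2.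
  have D_cvg : D @ \oo --> d ^+ 2.
    rewrite /D expr2; under eq_fun do rewrite expr2.
    exact: cvgM.
  apply: (@squeeze0 _ _ (fun k => c^-1 * (D k - D k.+1))).
    move=> k; rewrite r0 /= -(@ler_pM2l _ c) // mulrA divff ?gt_eqF // mul1r.
    have := (step k z0 Uz0).1; rewrite -/(D k) -/(D k.+1).
    have : c * r k <= alpha k * (2 - alpha k) * r k by rewrite ler_wpM2r.
    lra.
  rewrite -(mulr0 c^-1) -(subrr (d ^+ 2)).
  apply: cvgMl_tmp; apply: cvgB => //.
  by rewrite (cvg_shiftS D).
split=> // [|i].
  apply/norm_cvg0P/sqr_cvg0.
  apply: (@squeeze0 _ _ (fun k => 4 * r k)) => [k|].
    rewrite sqr_ge0 /=; apply: le_trans (step k z0 Uz0).2 _.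
    rewrite ler_wpM2r // (_ : 4 = 2 ^+ 2); last by rewrite -natrX.
    rewrite ler_pXn2r ?nnegrE //.
    by have /andP[_ /le_trans] := a_bounds k; apply; exact: ltW.
  by rewrite -(mulr0 4); apply: cvgMl_tmp.
apply/sqr_cvg0; apply: (@squeeze0 _ _ (fun k => w_lo^-1 * r k)) => [k|].
  rewrite sqr_ge0 /=; case: ifP => iA; last first.
    by rewrite expr0n mulr_ge0 // invr_ge0 ltW.
  rewrite -(@ler_pM2l _ w_lo) // [leRHS]mulrA divff ?gt_eqF // mul1r.
  rewrite /r (bigD1 i) //= -[leLHS]addr0 lerD //.
    by rewrite ler_wpM2r ?sqr_ge0 ?w_bounds.
  by apply: sumr_ge0 => j /andP[/w0 wj _]; rewrite mulr_ge0 ?sqr_ge0.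
by rewrite -(mulr0 w_lo^-1); apply: cvgMl_tmp.
Qed.

(** * Convergence of the iterative scheme *)

Theorem theorem16 (R : realType) (H : completeNormedModType R)
  (dot : {dot H for idfun}) (dot_norm : induces_norm dot)
  (m : nat) (U : 'I_m -> H -> H) (p : 'I_m -> H -> R) (C : 'I_m -> set H)
  (U_cutter : forall i, cutter dot (U i))
  (p_ge0 : forall i x, 0 <= p i x)
  (C_Fix : forall i, C i = Fix (U i))
  (C_p : forall i, C i = p i @^-1` [set 0])
  (C_neq0 : \bigcap_i C i !=set0)
  (I J : nat -> {set 'I_m}) (alpha : nat -> R) (omega : nat -> 'I_m -> R)
  (x : nat -> H)
  (IJ : forall k, I k \subset J k)
  (alpha_02 : forall k, 0 < alpha k < 2)
  (omega_01 : forall k i, i \in I k -> 0 < omega k i <= 1)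
  (omega_sum : forall k, \sum_(i in I k) omega k i = 1)
  (x_rec : forall k,
     x k.+1 = x k + alpha k *: (\sum_(i in I k) omega k i *: U i (x k) - x k))
  (alpha_lo alpha_hi omega_lo : R)
  (alpha_lo_01 : 0 < alpha_lo <= 1)
  (omega_lo_01 : 0 < omega_lo <= 1)
  (alpha_hi_12 : 1 <= alpha_hi < 2)
  (alpha_bounds : forall k, alpha_lo <= alpha k <= alpha_hi)
  (omega_bounds : forall k i, i \in I k -> omega_lo <= omega k i <= 1)
  (s : nat) (s_ge1 : (1 <= s)%N)
  (J_cover : forall k,
     (\bigcup_(k <= l < k + s) J l)%SET = [set: 'I_m]%SET)
  (p_IJ :
     \big[Num.max/0]_(i in I k) p i (x k) @[k --> \oo] --> (0 : R) ->
     \big[Num.max/0]_(j in J k) p j (x k) @[k --> \oo] --> (0 : R))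
  (p_U : forall y : nat -> H, bounded_fun y -> forall i,
     p i (y k) @[k --> \oo] --> (0 : R) <->
     `|U i (y k) - y k| @[k --> \oo] --> (0 : R)) :
  ((forall i, weakly_regular dot (U i)) ->
     exists2 xinf : H, (\bigcap_i C i) xinf & weak_cvg dot x xinf) /\
  ((forall i, boundedly_regular (U i)) ->
   boundedly_regular_family (fun i => Fix (U i)) ->
     exists xinf : H,
       [/\ (\bigcap_i C i) xinf, weak_cvg dot x xinf & x @ \oo --> xinf]).
Proof.
have CE : \bigcap_i C i = \bigcap_i Fix (U i).
  by apply: eq_bigcapr => i _; exact: C_Fix.
have [z Cz] := C_neq0.
have Uz i : U i z = z by have : C i z := Cz i Logic.I; rewrite C_Fix.
have pz i : p i z = 0 by have : C i z := Cz i Logic.I; rewrite C_p.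
have [/andP[a_lo0 _] /andP[w_lo0 _] /andP[_ a_hi2]] :=
  And3 alpha_lo_01 omega_lo_01 alpha_hi_12.
have [|k i /omega_bounds/andP[]//|fejer dx resI] :=
  averaged_cutters_residuals _ _ _ dot_norm _ _ _ _ _ _ _ _ _ U_cutter _
    a_lo0 a_hi2 alpha_bounds w_lo0 _ omega_sum x_rec.
  by exists z; rewrite -CE.
rewrite -CE in fejer.
have x_bounded : bounded_fun x.
  apply/bounded_seqP; exists (`|x 0%N - z| + `|z|) => k.
  have := ler_normD (x k - z) z; rewrite subrK => /le_trans; apply.
  rewrite lerD2r; elim: k => // k; exact: le_trans (fejer _ _ Cz).
have transfer i (A : nat -> {set 'I_m}) :=
  residual_transfer _ _ _ (p i) (fun k => i \in A k) x z
    (fun y yb => p_U y yb i) x_bounded (Uz i) (pz i).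
(* From the residuals over [I k] to proximities over [I k], then to
   proximities over [J k], and back to residuals over [J k]. *)
have resJ i : (if i \in J k then `|U i (x k) - x k| else 0)
    @[k --> \oo] --> (0 : R).
  apply/transfer; have := p_IJ; rewrite !cvg_bigmax_in0 //; apply.
  by move=> j; apply/transfer.
have cover i k : {l | (k <= l < k + s)%N /\ i \in J l}.
  apply: cid; have : i \in (\bigcup_(k <= l < k + s) J l)%SET.
    by rewrite J_cover inE.
  by move=> /mem_bigcup_nat[l kl il]; exists l.
pose l i k := sval (cover i k).
have lP i k : (k <= l i k < k + s)%N /\ i \in J (l i k) := svalP (cover i k).
have l_ge i k : (k <= l i k)%N by have [/andP[]] := lP i k.
have dxl i : x (l i k) - x k @[k --> \oo] --> (0 : H).
  by apply: (cvg0_window _ _ _ s) => // k; have [] := lP i k.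
have res_l i : `|U i (x (l i k)) - x (l i k)| @[k --> \oo] --> (0 : R).
  have := cvg_comp _ _ (cvgn_id_le _ (l_ge i)) (resJ i).
  by apply: cvg_trans; apply: near_eq_cvg; near=> k; have [_ /= ->] := lP i k.
split=> [Uweak|Ubounded [_ famB]].
  apply: (opial_weak_cvg _ _ _ dot_norm) => //.
    by move=> z' Cz'; apply: fejer_norm_cvg => k; exact: fejer.
  (* the subsequence [h] is moved to the nearby times at which the [i]-th
     residual is small, without changing its weak limit *)
  move=> h y h_ge xhy i _; rewrite C_Fix; apply: (Uweak i).2 (x \o l i \o h) _ _ _.
    apply: (weak_cvg_shift _ _ _ dot_norm) xhy.
    exact: (cvg_comp _ _ (cvgn_id_le _ h_ge) (dxl i)).
  apply/norm_cvg0P; exact: (cvg_comp _ _ (cvgn_id_le _ h_ge) (res_l i)).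
have dist_i i : dist (x k) (Fix (U i)) @[k --> \oo] --> (0 : R).
  apply: (@squeeze0 _ _ (fun k => `|x (l i k) - x k| + dist (x (l i k)) (Fix (U i)))).
    move=> k; rewrite dist_ge0 distrC; apply: dist_le_add.
    by exists z; exact: Uz.
  rewrite -(addr0 0); apply: cvgD; first exact/norm_cvg0P.
  apply: (Ubounded i).2 => //.
  have /bounded_seqP[M xM] := x_bounded.
  by apply/bounded_seqP; exists M.
have dist_C : dist (x k) (\bigcap_i C i) @[k --> \oo] --> (0 : R).
  rewrite CE; apply: famB => //.
  rewrite [X in X @ _ --> _](_ : _ = fun k =>
      \big[Num.max/0]_(i in [set: 'I_m]%SET) dist (x k) (Fix (U i))); last first.
    by apply/funext => k; apply: eq_bigl => i; rewrite finset.in_setT.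
  apply/(cvg_bigmax_in0 _ _ (fun=> [set: 'I_m]%SET)
    (fun k i => dist (x k) (Fix (U i)))) => [k i|i]; first exact: dist_ge0.
  rewrite [X in X @ _ --> _](_ : _ = fun k => dist (x k) (Fix (U i))) //.
  by apply/funext => k; rewrite finset.in_setT.
have [y xy near_y] := fejer_cvg _ _ x _ C_neq0 fejer dist_C.
exists y; split=> //; last exact: (cvg_weak _ _ _ dot_norm).
move=> i _; rewrite C_Fix; apply: (cutter_Fix_adherent _ _ _ dot_norm) => // e e0.
by have [z' Cz' yz'] := near_y _ e0; exists z' => //; rewrite -C_Fix; exact: Cz'.
Unshelve. all: by end_near. Qed.
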